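(* Let $K$ be a field, let $n\ge1$ and $d$ be natural numbers, let $\Lambda\subseteq K[X_1,\ldots,X_n]$ be a set of polynomials of total degree at most $d$, and let $f\in K[X_1,\ldots,X_n]$ have total degree at most $d$. If $f^k\in(\Lambda)$ for some $k$, then $f^{\mathfrak{d}_{n+1}(d+1)}\in(\Lambda)$.
   Context: $(\Lambda)$ denotes the ideal generated by $\Lambda$, and $\mathfrak{d}_n(b)=(2b)^{2^n}$. *)

(* Defs.v *)
From mathcomp Require Import all_boot all_algebra.
From mathcomp Require Import mpoly.

Set Implicit Arguments.
Unset Strict Implicit.
Unset Printing Implicit Defensive.

Import GRing.Theory.

Local Open Scope ring_scope.

(* [L] is an arbitrary, possibly infinite, set of generators; taking [m = 0]
   gives [ideal_gen L 0] even for an empty [L]. *)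
Definition ideal_gen (R : comNzRingType) (L : R -> Prop) (x : R) : Prop :=
  exists (m : nat) (a g : 'I_m -> R),
    (forall i, L (g i)) /\ x = \sum_(i < m) a i * g i.

(* [msize p] is one more than the total degree of [p], and [0] for [p = 0]. *)
Definition tdeg_le (n : nat) (R : nzRingType) (p : {mpoly R[n]}) (d : nat) :
  Prop := (msize p <= d.+1)%N.

Definition frakd (n b : nat) : nat := ((2 * b) ^ (2 ^ n))%N.

(* Main.v *)
Require Import Defs.
From HB Require Import structures.
From mathcomp Require Import all_boot all_algebra.
From mathcomp Require Import mpoly.
From mathcomp Require Import generic_quotient.
From mathcomp Require Import zify ring.

Set Implicit Arguments.
Unset Strict Implicit.
Unset Printing Implicit Defensive.

Import GRing.Theory.

Local Open Scope ring_scope.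
Local Open Scope quotient_scope.

Local Notation tofrac := (@FracField.tofrac _).

(** The exponent is found by bounding the degrees in Rabinowitsch's trick. If
    f^k is in the ideal generated by the g_i, then with a new variable T there
    is an identity 1 = sum_i a_i g_i + c (1 - T f) in n + 1 variables: write 1
    as T^k f^k + (1 - (T f)^k). If the a_i can be chosen of degree at most D,
    substituting T := 1/f and multiplying by f^D removes all denominators and
    the last term, and leaves f^D in the ideal of the g_i.

    The bound D = (2 (d + 1))^(2^(n+1)) is Hermann's, for one linear equation
    in n + 1 variables whose coefficients have degree at most d + 1. It is
    proved here for a system of m equations over K[X_0, ..., X_(n-1)], by
    elimination of one variable at a time ([hermann_bound]):
    - a maximal nonzero minor of the system selects r <= m rows that imply the
      others ([maximal_minor]);
    - over an infinite field, a linear change of coordinates makes this minor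
      monic in X_0, up to a constant ([exists_shear_unit_lead]);
    - dividing the unknowns by the minor, and correcting with Cramer's rule,
      gives a solution whose degree in X_0 is less than r d
      ([cramer_division]);
    - the coefficients of such a solution in X_0 solve a linear system over a
      polynomial ring in one variable fewer, with at most 2 m^2 d equations of
      degree at most d.
    The quantity u = 2 m d thus becomes 2 (2 m^2 d) d = u^2 at each step, which
    produces the double exponential u^(2^n).

    A generic direction exists when the field is infinite, so K is first
    replaced by K(t). An identity over K(t) whose left hand side and generators
    have coefficients in K then descends to K:
    clear the denominators, then compare one coefficient of the powers of t
    ([ideal_membership_descent]). An infinite field is presented below by an
    injection of the natural numbers into it. *)

(** * Degrees of multivariate polynomials *)

Lemma mpoly_rmorphE (n : nat) (R : comNzRingType) (S : comNzRingType)
    (g : {rmorphism {mpoly R[n]} -> S}) (p : {mpoly R[n]}) :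
  g p = mmap (g \o @mpolyC n R) (fun i => g 'X_i) p.
Proof.
rewrite {1}[p]mpolyE rmorph_sum; apply: eq_bigr => m _ /=.
rewrite -mul_mpolyC rmorphM mpolyXE_id rmorph_prod.
by congr (_ * _); apply: eq_bigr => i _; rewrite rmorphXn.
Qed.

Lemma msizeM_leq (n : nat) (R : idomainType) (p q : {mpoly R[n]}) :
  (msize (p * q) <= (msize p + msize q).-1)%N.
Proof.
have [->|p0] := eqVneq p 0; first by rewrite mul0r msize0.
have [->|q0] := eqVneq q 0; first by rewrite mulr0 msize0.
by rewrite msizeM.
Qed.

Lemma tdeg_leM (n : nat) (R : idomainType) (p q : {mpoly R[n]}) (d e : nat) :
  tdeg_le p d -> tdeg_le q e -> tdeg_le (p * q) (d + e).
Proof.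
rewrite /tdeg_le => hp hq; apply: leq_trans (msizeM_leq _ _) _.
rewrite -subn1 leq_subLR; apply: leq_trans (leq_add hp hq) _.
by rewrite addSn addnS.
Qed.

Lemma msize_sum_leq (n : nat) (R : nzRingType) (I : Type) (s : seq I)
    (P : pred I) (F : I -> {mpoly R[n]}) (b : nat) :
  (forall i, P i -> (msize (F i) <= b)%N) ->
  (msize (\sum_(i <- s | P i) F i) <= b)%N.
Proof.
move=> Fb; apply: (big_ind (fun p => msize p <= b)%N) => //.
  by rewrite msize0.
move=> p q hp hq; apply: leq_trans (msizeD_le _ _) _.
by rewrite geq_max hp.
Qed.

Lemma msize_mmap_linear (k n : nat) (K : idomainType)
    (h : 'I_k -> {mpoly K[n]}) (p : {mpoly K[k]}) :
  (forall i, (msize (h i) <= 2)%N) ->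
  (msize (mmap (@mpolyC n K) h p) <= msize p)%N.
Proof.
move=> hh; rewrite /mmap big_seq; apply: msize_sum_leq => m mp.
apply: leq_trans (_ : (mdeg m).+1 <= _)%N; last exact: msize_mdeg_lt.
rewrite mul_mpolyC; apply: leq_trans (msizeZ_le _ _) _.
rewrite mdegE /mmap1.
elim: (index_enum _) => [|i s IH]; first by rewrite !big_nil msize1.
rewrite !big_cons; apply: tdeg_leM => //.
elim: (m i) => [|j IHj]; first by rewrite /tdeg_le expr0 msize1.
by rewrite exprS -[j.+1]/(1 + j)%N; apply: tdeg_leM => //; apply: hh.
Qed.

(** * Polynomials in one distinguished variable, and linear changes of it *)

(** The total degree of [q], in all n + 1 variables, is less than [s]. Stated
    on coefficients, so that it bounds at once the degree in the distinguished
    variable and the degree of each coefficient. *)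
Definition total_le (n : nat) (R : nzRingType) (s : nat)
    (q : {poly {mpoly R[n]}}) : Prop :=
  forall k, (msize q`_k <= s - k)%N.

Section TotalLe.
Variables (n : nat) (K : fieldType).
Implicit Types (p q : {poly {mpoly K[n]}}).

Lemma total_le_sum (I : Type) (s : seq I) (P : pred I)
    (F : I -> {poly {mpoly K[n]}}) e :
  (forall i, P i -> total_le e (F i)) ->
  total_le e (\sum_(i <- s | P i) F i).
Proof.
move=> Fe k; rewrite coef_sum; apply: msize_sum_leq => i Pi.
exact: Fe.
Qed.

Lemma total_leM p q e e' :
  total_le e p -> total_le e' q -> total_le (e + e').-1 (p * q).
Proof.
move=> hp hq k; rewrite coefM; apply: msize_sum_leq => -[i /= lei] _.
have [->|p0'] := eqVneq p`_i 0; first by rewrite mul0r msize0.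
have [->|q0'] := eqVneq q`_(k - i) 0; first by rewrite mulr0 msize0.
move: (hp i) (hq (k - i)%N); have p0 := p0'; have q0 := q0'.
rewrite -msize_poly_eq0 in p0; rewrite -msize_poly_eq0 in q0.
rewrite (msizeM p0' q0') {p0' q0'}; move: p0 q0.
move: (msize p`_i) (msize q`_(k - i)) => x y; lia.
Qed.

Lemma total_leX p e k :
  total_le e.+1 p -> total_le (e * k).+1 (p ^+ k).
Proof.
move=> hp; elim: k => [|k IH].
  by case=> [|k]; rewrite expr0 coef1 ?muln0 /= ?msize1 ?msize0.
by rewrite exprS; have := total_leM hp IH; rewrite mulnS addSn addnS.
Qed.

Lemma total_le_size p e : total_le e p -> (size p <= e)%N.
Proof.
move=> hp; apply/leq_sizeP => j lej; apply/eqP.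
by rewrite -msize_poly_eq0 -leqn0 (leq_trans (hp j)) // leqn0 subn_eq0.
Qed.

Lemma total_leS p e e' : (e <= e')%N -> total_le e p -> total_le e' p.
Proof. by move=> le hp k; apply: leq_trans (hp k) _; rewrite leq_sub2r. Qed.

Lemma total_le_prod (I : Type) (s : seq I) (F : I -> {poly {mpoly K[n]}})
    (E : I -> nat) :
  (forall i, total_le (E i).+1 (F i)) ->
  total_le (\sum_(i <- s) E i).+1 (\prod_(i <- s) F i).
Proof.
move=> hF; elim: s => [|i s IH].
  by rewrite !big_nil => -[|k]; rewrite coef1 /= ?msize1 ?msize0.
rewrite !big_cons; have := total_leM (hF i) IH.
by rewrite addSn addnS.
Qed.

End TotalLe.

Section LinearChange.
Variables (n : nat) (K : fieldType) (c : 'I_n.+1 -> K).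

(** The linear change X_0 := c_0 T, X_(j+1) := X_j + c_(j+1) T, whose result is
    read as a polynomial in T: moving along T is moving in the direction [c]. *)
Definition shear_var (i : 'I_n.+1) : {poly {mpoly K[n]}} :=
  (if unlift ord0 i is Some j then 'X_j else 0)%:P + (c i)%:MP *: 'X.

Definition shear : {mpoly K[n.+1]} -> {poly {mpoly K[n]}} :=
  mmap (polyC \o @mpolyC n K) shear_var.

HB.instance Definition _ := GRing.RMorphism.on shear.

Definition unshear_mpoly : {mpoly K[n]} -> {mpoly K[n.+1]} :=
  mmap (@mpolyC n.+1 K)
       (fun j => 'X_(lift ord0 j) - (c (lift ord0 j) / c ord0) *: 'X_ord0).

HB.instance Definition _ := GRing.RMorphism.on unshear_mpoly.

Definition unshear (q : {poly {mpoly K[n]}}) : {mpoly K[n.+1]} :=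
  (map_poly unshear_mpoly q).[(c ord0)^-1 *: 'X_ord0].

HB.instance Definition _ := GRing.RMorphism.copy unshear
  (horner_eval ((c ord0)^-1 *: 'X_ord0) \o map_poly unshear_mpoly).

(** Both sides are ring morphisms, so that it suffices to compare them on the
    constants and on the variables. *)
Lemma shearK : c ord0 != 0 -> cancel shear unshear.
Proof.
move=> c0 p; rewrite -[LHS]/((unshear \o shear) p) mpoly_rmorphE.
rewrite -[RHS]/(idfun p) [RHS]mpoly_rmorphE /mmap.
apply: eq_bigr => m _; congr (_ * _).
  by rewrite /= /shear mmapC /unshear /= map_polyC hornerC /= /unshear_mpoly mmapC.
apply: mmap1_eq => i /=.
rewrite /shear mmapX mmap1U /shear_var /unshear rmorphD /= linearZ /= map_polyC map_polyX /=.
rewrite hornerD hornerC hornerZ hornerX /unshear_mpoly mmapC mul_mpolyC scalerA.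
case: unliftP => [j ->|->].
  by rewrite mmapX mmap1U subrK.
by rewrite mmap0 add0r divff // scale1r.
Qed.

Lemma total_le_shear p : total_le (msize p) (shear p).
Proof.
rewrite /shear; rewrite /mmap big_seq; apply: total_le_sum => m mp.
apply: (total_leS (e := (mdeg m).+1)); first exact: msize_mdeg_lt.
rewrite -[(mdeg m).+1]/(1 + (mdeg m).+1).-1; apply: total_leM.
  by case=> [|k] /=; rewrite coefC /= ?msize0 // msizeC; case: eqP.
rewrite mdegE; apply: total_le_prod => i.
suff h : total_le 2 (shear_var i) by move: (total_leX (m i) h); rewrite mul1n.
case=> [|[|k]];
  rewrite coefD coefC coefZ coefX /= ?(mulr0, mulr1, addr0, add0r) ?msize0 //.
  by case: unlift => [j|]; rewrite ?msizeX ?mdeg1 ?msize0.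
by rewrite msizeC; case: eqP.
Qed.

(** Sending the remaining variables to 0 turns the monomial X^m into
    c^m T^|m|, so that only the homogeneous part of degree [e] contributes. *)
Lemma coef_shear_top p e :
  ((shear p)`_e)@_0%MM = (pihomog [measure of mdeg] e p).@[c].
Proof.
have -> : ((shear p)`_e)@_0%MM = ((map_poly (mcoeff 0%MM) \o shear) p)`_e.
  by rewrite /= coef_map.
rewrite mpoly_rmorphE /mmap coef_sum pihomogE raddf_sum /= [RHS]big_mkcond /=.
apply: eq_bigr => m _.
rewrite /= {1}/shear mmapC /= map_polyC /= mpolyCK coefCM.
have -> : mmap1 (fun i => map_poly (mcoeff 0) (shear 'X_i)) m =
          (\prod_i c i ^+ m i) *: 'X^(mdeg m).
  rewrite mdegE -prodrXr -scaler_prod; apply: eq_bigr => i _.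
  rewrite -exprZn; congr (_ ^+ _).
  rewrite /shear mmapX mmap1U /shear_var rmorphD /= linearZ /= map_polyC map_polyX /=.
  rewrite mpolyCK; case: unlift => [j|]; rewrite ?mcoeff0 ?add0r //.
  by rewrite mcoeffX -mdeg_eq0 mdeg1 add0r.
rewrite coefZ coefXn eq_sym; case: eqP => _; last by rewrite !mulr0.
by rewrite mevalZ mevalX mulr1.
Qed.

Lemma msize_unshear_leq (q : {poly {mpoly K[n]}}) e b :
  (size q <= e)%N -> (forall k, (msize q`_k <= b)%N) ->
  (msize (unshear q) <= b + e.-1)%N.
Proof.
move=> se qb; rewrite /unshear (horner_coef_wide _ (leq_trans (size_poly _ _) se)).
apply: msize_sum_leq => -[k ke] _; rewrite coef_map /=.
have [-> | qk0] := eqVneq q`_k 0; first by rewrite raddf0 mul0r msize0.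
case: b qb => [/(_ k)|b qb]; first by rewrite leqn0 msize_poly_eq0 (negPf qk0).
apply: (@leq_trans (b + k).+1); last by rewrite addSn ltnS leq_add2l; lia.
apply: tdeg_leM.
  apply: leq_trans (qb k); apply: msize_mmap_linear => i.
  apply: leq_trans (msizeD_le _ _) _; rewrite msizeN geq_max msizeX mdeg1 leqnn /=.
  by apply: leq_trans (msizeZ_le _ _) _; rewrite msizeX mdeg1.
rewrite exprZn /tdeg_le; apply: leq_trans (msizeZ_le _ _) _.
by rewrite mpolyXn msizeX mdegMn mdeg1 mul1n.
Qed.

End LinearChange.

(** * Generic coordinates over an infinite field *)

Lemma infinite_nonroot (K : idomainType) (e : nat -> K) (p : {poly K}) :
  injective e -> p != 0 -> exists x, p.[x] != 0.
Proof.
move=> inj_e p0.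
have [/allP h|/allPn [x _ hx]] := boolP (all (root p) (mkseq e (size p))); last by exists x.
have := max_poly_roots p0 (introT allP h); rewrite mkseq_uniq // size_mkseq ltnn.
by move/(_ isT).
Qed.

Lemma infinite_meval_neq0 (K : fieldType) (e : nat -> K) (n : nat)
    (p : {mpoly K[n]}) :
  injective e -> p != 0 -> exists c : 'I_n -> K, p.@[c] != 0.
Proof.
move=> inj_e; elim: n p => [|n IH] p p0.
  exists (fun=> 0); move: p0; rewrite (nvar0_mpolyC p) mevalC.
  by rewrite mpolyC_eq0.
(* This change of coordinates only singles out the first variable. *)
pose c (i : 'I_n.+1) : K := (i == ord0)%:R.
have c0 : c ord0 != 0 by rewrite /c eqxx oner_neq0.
have sp0 : shear c p != 0.
  by apply: contraNneq p0 => sp0; rewrite -(shearK c0 p) sp0 raddf0.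
have [x xP] := IH _ (etrans (congr1 negb (lead_coef_eq0 _)) sp0).
have qP : map_poly (meval x) (shear c p) != 0.
  by apply: contraNneq xP => q0; rewrite lead_coefE -coef_map q0 coef0.
have [t tP] := infinite_nonroot inj_e qP.
exists (fun i => if unlift ord0 i is Some j then x j else t).
move: tP; rewrite -[X in X != 0 -> _]/((horner_eval t \o (map_poly (meval x) \o shear c)) p).
rewrite mpoly_rmorphE; congr (_ != 0); rewrite /meval.
apply: eq_bigr => m _; congr (_ * _).
  by rewrite /= /shear mmapC /= map_polyC /= mevalC /horner_eval hornerC.
apply: mmap1_eq => i /=.
rewrite /shear mmapX mmap1U /shear_var rmorphD /= linearZ /= map_polyC map_polyX /=.
rewrite /horner_eval mevalC /c; case: unliftP => [j ->|->].
  by rewrite mevalXU eq_sym (negPf (neq_lift _ _)) scale0r addr0 hornerC.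
by rewrite eqxx meval0 add0r scale1r hornerX.
Qed.

(** The coefficient of the highest possible power of T is the value at [c] of
    the leading form of [p]; any direction where this form does not vanish is
    suitable. *)
Lemma exists_shear_unit_lead (K : fieldType) (e : nat -> K) (n : nat)
    (p : {mpoly K[n.+1]}) :
  injective e -> p != 0 ->
  exists c : 'I_n.+1 -> K,
    c ord0 != 0 /\ lead_coef (shear c p) \is a GRing.unit.
Proof.
move=> inj_e p0; pose s := (msize p).-1.
have sE : msize p = s.+1 by rewrite /s -mpolySpred.
pose h := pihomog [measure of mdeg] s p.
have h0 : h != 0.
  have: h@_(mlead p) != 0.
    rewrite /h pihomogE raddf_sum /= -big_filter (bigD1_seq (mlead p)) /=; first last.
    - by rewrite filter_uniq ?msupp_uniq.
    - by rewrite mem_filter mlead_supp //= andbT -eqSS mlead_deg ?sE.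
    rewrite big1 => [|m /negPf mp]; rewrite mcoeffZ mcoeffX ?mp ?mulr0 //.
    by rewrite eqxx mulr1 addr0 mleadc_eq0.
  by apply: contraNneq => ->; rewrite mcoeff0.
(* The factor X_0 makes the change of coordinates invertible. *)
have hX : h * 'X_ord0 != 0.
  by rewrite mulf_neq0 // -msize_poly_eq0 msizeX.
have [c] := infinite_meval_neq0 inj_e hX.
rewrite mevalM mulf_eq0 negb_or mevalXU => /andP[hc c0].
exists c; split=> //.
have top : (shear c p)`_s = (h.@[c])%:MP.
  rewrite -coef_shear_top; apply: msize1_polyC.
  by have := total_le_shear c p s; rewrite sE subSn // subnn.
have size_le := total_le_size (total_le_shear c p); rewrite sE in size_le.
have -> : lead_coef (shear c p) = (h.@[c])%:MP.
  rewrite lead_coefE -top; case: ltngtP size_le => // [|-> //].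
  rewrite ltnS => /leq_sizeP/(_ s (leqnn s)) /eqP.
  by rewrite top mpolyC_eq0 (negPf hc).
by apply: rmorph_unit; rewrite unitfE.
Qed.

(** * Linear systems over polynomial rings *)

(** Over the fraction field, a row basis of the matrix has a nonsingular
    square submatrix, and every row is a combination of the basis. *)
Lemma maximal_minor (R : idomainType) (I J : finType) (A : I -> J -> R) :
  exists (r : nat) (f : 'I_r -> I) (g : 'I_r -> J),
    [/\ (r <= #|I|)%N,
        \det (\matrix_(i, j) A (f i) (g j)) != 0
      & forall y : J -> R, (forall k, \sum_j A (f k) j * y j = 0) ->
        forall i, \sum_j A i j * y j = 0].
Proof.
pose M := \matrix_(i < #|I|, j < #|J|) tofrac (A (enum_val i) (enum_val j)).
pose f0 := maxrankfun M; pose N := rowsub f0 M.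
have Nfull : row_full N^T by rewrite /row_full mxrank_tr; apply: maxrowsub_free.
pose g0 := fullrankfun Nfull.
exists (\rank M), (enum_val \o f0), (enum_val \o g0); split.
- exact: rank_leq_row.
- rewrite -tofrac_eq0 -det_map_mx -unitfE -unitmxE -unitmx_tr.
  rewrite (_ : _^T = rowsub g0 N^T) ?fullrowsub_unit //.
  by apply/matrixP => i j; rewrite !mxE.
move=> y hy i; apply/eqP; rewrite -tofrac_eq0; apply/eqP.
pose v := \col_(j < #|J|) tofrac (y (enum_val j)).
have MvE k : (M *m v) k 0 = tofrac (\sum_j A (enum_val k) j * y j).
  rewrite mxE rmorph_sum /= [RHS](reindex (@enum_val J J)) /=; last first.
    exact: onW_bij (enum_val_bij _).
  by apply: eq_bigr => j _; rewrite !mxE rmorphM.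
have := MvE (enum_rank i); rewrite enum_rankK => <-.
have /submxP[C ->] : (M <= N)%MS by rewrite (eq_maxrowsub M).
suff Nv : N *m v = 0 by rewrite -mulmxA Nv mulmx0 mxE.
apply/colP => k; have hyk : \sum_j A (enum_val (f0 k)) j * y j = 0 := hy k.
transitivity ((M *m v) (f0 k) 0); last by rewrite MvE hyk rmorph0 mxE.
by rewrite !mxE; apply: eq_bigr => j _; rewrite !mxE.
Qed.

Lemma det_matrix_rmorph (R S : comNzRingType) (F : {rmorphism R -> S}) (r : nat)
    (a : 'I_r -> 'I_r -> R) :
  \det (\matrix_(i, j) F (a i j)) = F (\det (\matrix_(i, j) a i j)).
Proof.
by rewrite -det_map_mx; congr (\det _); apply/matrixP => i j; rewrite !mxE.
Qed.

Lemma size_det_leq (R : idomainType) (d r : nat) (M : 'M[{poly R}]_r) :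
  (forall i j, (size (M i j) <= d.+1)%N) -> (size (\det M) <= (r * d).+1)%N.
Proof.
move=> hM; rewrite /determinant; apply: (leq_trans (size_sum _ _ _)).
apply/bigmax_leqP => s _; rewrite size_Msign; apply: leq_trans (size_prod_leq _ _) _.
rewrite card_ord leq_subLR addnS ltnS.
apply: (@leq_trans (\sum_(i < r) d.+1)); first exact: leq_sum.
by rewrite sum_nat_const card_ord mulnS.
Qed.

(** Each unknown y_j = q_j D + z_j can be replaced by its remainder z_j modulo
    the minor D, at the price of adding w = adj(M) A q to the unknowns of the
    minor: indeed M w = D A q. The added term is small because D w =
    adj(M) (b - A z), where only remainders occur. The bound on [b] is strict,
    in terms of degrees, so that w has degree less than r d even when D is a
    constant. *)
Lemma cramer_division (R : idomainType) (r d : nat) (J : finType)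
    (A : 'I_r -> J -> {poly R}) (b : 'I_r -> {poly R}) (g : 'I_r -> J)
    (y : J -> {poly R}) :
  lead_coef (\det (\matrix_(i, j) A i (g j))) \is a GRing.unit ->
  (forall i j, (size (A i j) <= d.+1)%N) -> (forall i, (size (b i) <= d)%N) ->
  (forall i, \sum_j A i j * y j = b i) ->
  exists2 z : J -> {poly R},
    forall i, \sum_j A i j * z j = b i & forall j, (size (z j) <= r * d)%N.
Proof.
set M := \matrix_(i, j) _; set D := \det M => unitD szA szb Ay.
have szM i j : (size (M i j) <= d.+1)%N by rewrite mxE.
have szD : (size D <= (r * d).+1)%N by apply: size_det_leq szM.
have D0 : D != 0 by rewrite -lead_coef_eq0; apply: contraTneq unitD => ->; rewrite unitr0.
have szD_gt0 : (0 < size D)%N by rewrite size_poly_gt0.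
pose q j := y j %/ D; pose z j := y j %% D.
have yE j : y j = q j * D + z j by exact: Pdiv.IdomainUnit.divp_eq.
have szz j : (size (z j) < size D)%N by rewrite ltn_modp.
pose w := \adj M *m \col_i \sum_j A i j * q j.
have MwE : M *m w = \col_i (\sum_j A i j * q j * D).
  rewrite /w mulmxA mul_mx_adj mul_scalar_mx; apply/colP => i.
  by rewrite !mxE mulrC mulr_suml.
have Dw : D *: w = \adj M *m \col_i (b i - \sum_j A i j * z j).
  rewrite /w scalemxAr; congr (_ *m _); apply/colP => i; rewrite !mxE.
  rewrite -Ay -sumrB mulr_sumr; apply: eq_bigr => j _.
  rewrite (yE j); ring.
have szw k : (size (w k ord0) <= r * d)%N.
  have [-> | wk0] := eqVneq (w k ord0) 0.
    by rewrite size_poly0.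
  have szDw : (size (D * w k ord0)%R <= size D + r * d - 1)%N.
    have -> : D * w k ord0 = (D *: w) k ord0 by rewrite [RHS]mxE.
    rewrite Dw mxE; apply: leq_trans (size_sum _ _ _) _; apply/bigmax_leqP => l _.
    apply: leq_trans (size_polyMleq _ _) _; rewrite -!subn1 leq_sub2r //.
    have r_gt0 : (0 < r)%N by case: (r) l => [[]|].
    have -> : (size D + r * d = (r.-1 * d).+1 + (size D + d - 1))%N.
      by move: szD_gt0; case: (r) r_gt0 => // r' _; rewrite mulSn /=; lia.
    apply: leq_add.
      rewrite mxE /cofactor size_Msign.
      by apply: size_det_leq => i j; rewrite !mxE.
    rewrite mxE; apply: leq_trans (size_polyD _ _) _.
    rewrite size_polyN geq_max; apply/andP; split.
      by apply: leq_trans (szb l) _; move: szD_gt0; lia.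
    apply: leq_trans (size_sum _ _ _) _; apply/bigmax_leqP => j _.
    apply: leq_trans (size_polyMleq _ _) _.
    rewrite -subn1 leq_sub2r // addnC.
    apply: leq_trans (leq_add (leqnn _) (szA l j)) _.
    by rewrite addnS -addSn leq_add2r szz.
  move: szDw; rewrite size_mul // -subn1 leq_subLR subnKC ?addn_gt0 ?szD_gt0 //.
  by rewrite leq_add2l.
exists (fun j => z j + \sum_(k | g k == j) w k ord0) => [i|j].
  transitivity (\sum_j A i j * z j + (M *m w) i 0).
    under eq_bigr do rewrite mulrDr; rewrite big_split /=; congr (_ + _).
    under eq_bigr do rewrite mulr_sumr.
    rewrite (exchange_big_dep xpredT) //= mxE; apply: eq_bigr => k _.
    by rewrite (eq_bigl (pred1 (g k))) ?big_pred1_eq ?mxE // => j; rewrite eq_sym.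
  rewrite MwE mxE -Ay -big_split /=; apply: eq_bigr => j _.
  by rewrite (yE j); ring.
apply: leq_trans (size_polyD _ _) _; rewrite geq_max; apply/andP; split.
  by rewrite -ltnS (leq_trans (szz j)).
by apply: leq_trans (size_sum _ _ _) _; apply/bigmax_leqP.
Qed.

Lemma coef_linear_form (R : comNzRingType) (J : finType) (e : nat)
    (A : J -> {poly R}) (z : J * 'I_e -> R) (l : nat) :
  (\sum_j A j * \sum_(k < e) z (j, k) *: 'X^k)`_l =
  \sum_(jk : J * 'I_e) (A jk.1 * 'X^(jk.2))`_l * z jk.
Proof.
transitivity (\sum_j \sum_(k < e) (A j * 'X^k)`_l * z (j, k)); last first.
  by rewrite pair_bigA; apply: eq_bigr => -[].
rewrite coef_sum.
apply: eq_bigr => j _; rewrite mulr_sumr coef_sum; apply: eq_bigr => k _.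
by rewrite -scalerAr coefZ mulrC.
Qed.

(** The term [2 * m * d] added on the left absorbs the degrees lost in the
    induction: each eliminated variable costs less than m d, while the
    corresponding term grows from u to u^2. *)
Lemma hermann_bound (K : fieldType) (e : nat -> K) (n : nat) :
  injective e ->
  forall (I J : finType) (m d : nat) (A : I -> J -> {mpoly K[n]})
    (b : I -> {mpoly K[n]}),
  (#|I| <= m)%N ->
  (forall i j, tdeg_le (A i j) d) -> (forall i, (msize (b i) <= d)%N) ->
  (exists y : J -> {mpoly K[n]}, forall i, \sum_j A i j * y j = b i) ->
  exists2 y : J -> {mpoly K[n]},
    forall i, \sum_j A i j * y j = b i &
    forall j, (msize (y j) + 2 * m * d <= ((2 * m * d) ^ (2 ^ n)).+1)%N.
Proof.
move=> inj_e; elim: n => [|n IH] I J m d A b cardI szA szb [y0 Ay0].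
  (* Without variables every solution is constant. *)
  exists y0 => // j; rewrite (nvar0_mpolyC (y0 j)) msizeC expn0 expn1.
  by case: eqP => // _; apply: leqnSn.
have [r [f [g [ler minor0 kerA]]]] := maximal_minor A.
have [c [c0 unitD]] := exists_shear_unit_lead inj_e minor0.
pose A' i j := shear c (A (f i) j); pose b' i := shear c (b (f i)).
have szA' i j : (size (A' i j) <= d.+1)%N.
  by apply: leq_trans (szA (f i) j); apply: total_le_size (total_le_shear _ _).
have szb' i : (size (b' i) <= d)%N.
  by apply: leq_trans (szb (f i)); apply: total_le_size (total_le_shear _ _).
have Ay' i : \sum_j A' i j * shear c (y0 j) = b' i.
  by rewrite /b' -Ay0 rmorph_sum; apply: eq_bigr => j _; rewrite rmorphM.
have unitD' : lead_coef (\det (\matrix_(i, j) A' i (g j))) \is a GRing.unit.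
  by rewrite /A' det_matrix_rmorph.
have [z1 Az1 szz1] := cramer_division unitD' szA' szb' Ay'.
(* The system satisfied by the coefficients: the unknowns are those of T^k
   for k < r d, and both sides have degree less than r d + d in T. *)
set s := (r * d)%N in szz1.
pose A2 (il : 'I_r * 'I_(s + d)) (jk : J * 'I_s) := (A' il.1 jk.1 * 'X^(jk.2))`_(il.2).
pose b2 (il : 'I_r * 'I_(s + d)) := (b' il.1)`_(il.2).
have lerm : (r <= m)%N := leq_trans ler cardI.
have card2 : (#|{: 'I_r * 'I_(s + d)}| <= 2 * m * m * d)%N.
  rewrite card_prod !card_ord /s.
  have [->|r0] := posnP r; first by rewrite mul0n.
  apply: (@leq_trans (r * (2 * (r * d)))%N).
    by rewrite leq_mul2l mul2n -addnn leq_add2l leq_pmull ?orbT.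
  by rewrite mulnCA !mulnA !leq_mul.
have [] := IH _ _ _ d A2 b2 card2.
- move=> [i l] [j k]; rewrite /A2 /= coefMXn; case: ifP => _.
    by rewrite /tdeg_le msize0.
  apply: leq_trans (szA (f i) j).
  exact: leq_trans (total_le_shear _ _ _) (leq_subr _ _).
- move=> [i l]; apply: leq_trans _ (szb (f i)).
  exact: leq_trans (total_le_shear _ _ _) (leq_subr _ _).
- exists (fun jk : J * 'I_s => (z1 jk.1)`_(jk.2)) => -[i l]; rewrite /b2 /A2 /=.
  rewrite -Az1 -(coef_linear_form _ (fun jk => (z1 jk.1)`_(jk.2))); congr (_`_ _).
  have z1E j : \sum_(k < s) (z1 j)`_k *: 'X^k = z1 j.
    rewrite -poly_def; apply/polyP => k; rewrite coef_poly.
    by case: ltnP => // /(leq_trans (szz1 j))/leq_sizeP ->.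
  by under eq_bigr do rewrite z1E.
move=> z2 Az2 szz2.
pose y' j := \sum_(k < s) z2 (j, k) *: 'X^k.
have szy' j : (size (y' j) <= s)%N.
  apply: leq_trans (size_sum _ _ _) _; apply/bigmax_leqP => k _.
  by apply: leq_trans (size_scale_leq _ _) _; rewrite size_polyXn.
have Ay'' i : \sum_j A' i j * y' j = b' i.
  apply/polyP => l; have [ls|ls] := ltnP l (s + d).
    by rewrite coef_linear_form; apply: (Az2 (i, Ordinal ls)).
  rewrite [RHS]nth_default; last by rewrite (leq_trans (szb' i)) // (leq_trans _ ls) ?leq_addl.
  rewrite nth_default // (leq_trans _ ls) //.
  apply: leq_trans (size_sum _ _ _) _; apply/bigmax_leqP => j _.
  apply: leq_trans (size_polyMleq _ _) _; rewrite -subn1 leq_subLR add1n -addSn addnC.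
  by rewrite addSnnS; apply: leq_add (szy' j) (szA' i j).
(* The new solution and the old one agree on the selected rows, hence on all. *)
exists (fun j => unshear c (y' j)) => [i|j].
  apply/eqP; rewrite -subr_eq0 -Ay0 -sumrB; apply/eqP.
  under eq_bigr do rewrite -mulrBr.
  apply: kerA => k; under eq_bigr do rewrite mulrBr.
  rewrite sumrB Ay0 -(shearK c0 (b (f k))) -[shear c _]/(b' k) -Ay'' rmorph_sum.
  apply/eqP; rewrite subr_eq0; apply/eqP/eq_bigr => l _.
  by rewrite rmorphM /A' /= shearK.
set u := (2 * m * d)%N; set N := (u ^ (2 ^ n.+1))%N.
have uu : (2 * (2 * m * m * d) * d)%N = (u * u)%N by rewrite /u; lia.
have NE : ((u * u) ^ (2 ^ n))%N = N by rewrite /N expnS expnM -mulnn.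
rewrite uu NE in szz2.
have leN : (u * u <= N)%N.
  rewrite /N mulnn; have [->|u0] := posnP u; first by rewrite exp0n.
  by rewrite leq_pexp2l // -[X in (X <= _)%N]expn1 leq_pexp2l.
have szy2 k : (msize (y' j)`_k <= N.+1 - u * u)%N.
  rewrite /y' coef_sum; apply: msize_sum_leq => k' _; rewrite coefZ coefXn.
  case: eqP => _; last by rewrite mulr0 msize0.
  by rewrite mulr1 leq_subRL ?(leqW leN) // addnC; apply: szz2.
have := msize_unshear_leq c (szy' j) szy2.
have sle : (s <= m * d)%N by rewrite /s leq_mul2r lerm orbT.
have cost : (s.-1 + u <= u * u)%N.
  have -> : u = (2 * (m * d))%N by rewrite /u mulnA.
  move: (m * d)%N sle => [|x] lex; first by move: lex; rewrite leqn0 => /eqP ->.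
  apply: (@leq_trans (4 * x.+1)); first by lia.
  by rewrite mulnACA leq_mul2l leq_pmulr.
move: cost leN; move: (u * u)%N (msize _) => v t; lia.
Qed.

(** * Rabinowitsch's trick *)

Section Rabinowitsch.
Variables (K : fieldType) (n : nat) (f : {mpoly K[n]}).

(** The first variable of the larger ring is kept free, to play the role of T. *)
Definition wlift : {mpoly K[n]} -> {mpoly K[n.+1]} :=
  mmap (@mpolyC n.+1 K) (fun j => 'X_(lift ord0 j)).

HB.instance Definition _ := GRing.RMorphism.on wlift.

Lemma msize_wlift p : (msize (wlift p) <= msize p)%N.
Proof. by apply: msize_mmap_linear => i; rewrite msizeX mdeg1. Qed.

(** The substitution T := 1/f. *)
Definition rab_var (i : 'I_n.+1) : {fraction {mpoly K[n]}} :=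
  if unlift ord0 i is Some j then tofrac 'X_j else (tofrac f)^-1.

Definition rab_eval : {mpoly K[n.+1]} -> {fraction {mpoly K[n]}} :=
  mmap (tofrac \o @mpolyC n K) rab_var.

HB.instance Definition _ := GRing.RMorphism.on rab_eval.

Lemma rab_eval_wlift p : rab_eval (wlift p) = tofrac p.
Proof.
rewrite -[LHS]/((rab_eval \o wlift) p) mpoly_rmorphE [RHS]mpoly_rmorphE.
apply: eq_bigr => m _; congr (_ * _).
  by rewrite /= /wlift mmapC /rab_eval mmapC.
apply: mmap1_eq => j /=.
by rewrite /wlift mmapX mmap1U /rab_eval mmapX mmap1U /rab_var liftK.
Qed.

(** T occurs with exponent at most [D] in each monomial of [p]. *)
Lemma rab_eval_denominator D p : f != 0 -> tdeg_le p D ->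
  exists q, tofrac f ^+ D * rab_eval p = tofrac q.
Proof.
move=> f0 hp; rewrite /rab_eval /mmap mulr_sumr big_seq.
apply: (big_ind (fun x => exists q, x = tofrac q)).
- by exists 0; rewrite rmorph0.
- by move=> _ _ [q ->] [q' ->]; exists (q + q'); rewrite rmorphD.
move=> m mp; have mD : (m ord0 <= D)%N.
  have := leq_trans (msize_mdeg_lt mp) hp; rewrite ltnS mdegE big_ord_recl.
  exact: leq_trans (leq_addr _ _).
exists ((p@_m)%:MP * (f ^+ (D - m ord0) * \prod_(j < n) 'X_j ^+ m (lift ord0 j))).
rewrite !rmorphM rmorph_prod /= mulrCA; congr (_ * _).
rewrite /mmap1 big_ord_recl mulrA; congr (_ * _).
  rewrite /rab_var unlift_none exprVn rmorphXn -{1}(subnK mD) exprD mulfK //.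
  by rewrite expf_neq0 // tofrac_eq0.
by apply: eq_bigr => j _; rewrite /rab_var liftK rmorphXn.
Qed.

End Rabinowitsch.

Lemma nullstellensatz_exponent_infinite (K : fieldType) (e : nat -> K)
    (n d m : nat) (g a : 'I_m -> {mpoly K[n]}) (f : {mpoly K[n]}) (k : nat) :
  injective e -> (forall i, tdeg_le (g i) d) -> tdeg_le f d ->
  f ^+ k = \sum_i a i * g i ->
  exists a' : 'I_m -> {mpoly K[n]},
    f ^+ frakd n.+1 d.+1 = \sum_i a' i * g i.
Proof.
move=> inj_e hg hf fk; have [-> | f0] := eqVneq f 0.
  exists (fun=> 0); rewrite expr0n /frakd expn_eq0 mul2n double_eq0 /=.
  by rewrite big1 // => i _; rewrite mul0r.
pose A (_ : unit) (j : 'I_m.+1) : {mpoly K[n.+1]} :=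
  if unlift ord0 j is Some i then wlift (g i) else 1 - 'X_ord0 * wlift f.
have bigA y : \sum_j A tt j * y j =
    (1 - 'X_ord0 * wlift f) * y ord0 + \sum_i wlift (g i) * y (lift ord0 i).
  rewrite big_ord_recl /A unlift_none; congr (_ + _).
  by apply: eq_bigr => i _; rewrite liftK.
have [] := @hermann_bound K e n.+1 inj_e _ _ 1 d.+1 A (fun=> 1).
- by rewrite card_unit.
- move=> [] j; rewrite /A; case: unlift => [i|].
    by apply: leq_trans (msize_wlift _) _; apply: leq_trans (hg i) _.
  apply: leq_trans (msizeD_le _ _) _; rewrite geq_max msize1 msizeN /=.
  rewrite -[d.+1]/(1 + d)%N; apply: tdeg_leM; first by rewrite /tdeg_le msizeX mdeg1.
  exact: leq_trans (msize_wlift _) hf.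
- by move=> _; rewrite msize1.
  (* 1 = T^k f^k + (1 - T f) (1 + T f + ... + (T f)^(k-1)). *)
- exists (fun j => if unlift ord0 j is Some i then 'X_ord0 ^+ k * wlift (a i)
                   else \sum_(l < k) ('X_ord0 * wlift f) ^+ l).
  move=> []; rewrite bigA unlift_none; under [X in _ + X]eq_bigr do rewrite liftK.
  have -> : \sum_i wlift (g i) * ('X_ord0 ^+ k * wlift (a i)) =
            ('X_ord0 * wlift f) ^+ k.
    rewrite exprMn -rmorphXn fk rmorph_sum mulr_sumr; apply: eq_bigr => i _.
    by rewrite rmorphM /=; ring.
  by rewrite -opprB mulNr -subrX1 opprB subrK.
move=> y Ay szy.
set D := frakd _ _.
have tdy i : tdeg_le (y (lift ord0 i)) D.
  by apply: leq_trans (szy (lift ord0 i)); rewrite ?leq_addr.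
have /fin_all_exists [q qE] i := rab_eval_denominator f0 (tdy i).
exists q; apply/eqP; rewrite -tofrac_eq; apply/eqP.
have ev0 : rab_eval f (1 - 'X_ord0 * wlift f) = 0.
  rewrite rmorphB rmorph1 rmorphM /= rab_eval_wlift.
  by rewrite /rab_eval mmapX mmap1U /rab_var unlift_none mulVf ?subrr ?tofrac_eq0.
have := congr1 (fun x => tofrac f ^+ D * rab_eval f x) (Ay tt).
rewrite bigA rmorph1 mulr1 rmorphD rmorphM /= ev0 mul0r add0r.
rewrite rmorph_sum mulr_sumr rmorphXn => <-.
rewrite rmorph_sum; apply: eq_bigr => i _.
by rewrite !rmorphM /= rab_eval_wlift -qE; ring.
Qed.

(** * Descent from K(t) to K *)

Lemma fraction_tofrac_mul (R : idomainType) (x : {fraction R}) :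
  exists2 q : R, q != 0 & exists p, tofrac q * x = tofrac p.
Proof.
elim/quotW: x => u; exists (\d_u); first exact: denom_ratioP.
exists (\n_u); unlock FracField.tofrac.
rewrite -[LHS]FracField.pi_mul; apply/eqmodP; rewrite /= FracField.equivfE /FracField.mulf.
by rewrite !numden_Ratio ?(oner_neq0, mul1r, mulr1) ?denom_ratioP // mulrC.
Qed.

Lemma mpoly_common_denominator (R : idomainType) (n : nat)
    (a : {mpoly {fraction R}[n]}) :
  exists2 q : R, q != 0 &
    exists P : {mpoly R[n]}, map_mpoly tofrac P = tofrac q *: a.
Proof.
elim/mpolyind: a => [|c m a _ _ [q q0 [P PE]]].
  by exists 1; [exact: oner_neq0 | exists 0; rewrite rmorph0 scaler0].
have [s s0 [r rE]] := fraction_tofrac_mul c.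
exists (q * s); first by rewrite mulf_neq0.
exists ((q * r) *: 'X_[m] + s *: P).
rewrite rmorphD /= !map_mpolyZ map_mpolyX PE scalerDr !scalerA -!rmorphM.
congr (_ *: _ + _ *: _); first by rewrite !rmorphM -mulrA rE.
by rewrite mulrC.
Qed.

Lemma map_mpoly_compE (R S T : nzRingType) (n : nat) (F : {rmorphism S -> T})
    (G : {rmorphism R -> S}) (p : {mpoly R[n]}) :
  map_mpoly (F \o G) p = map_mpoly F (map_mpoly G p).
Proof. by apply/mpolyP => m; rewrite !mcoeff_map_mpoly. Qed.

Lemma map_mpoly_inj (R S : nzRingType) (n : nat) (F : {rmorphism R -> S}) :
  injective F -> injective (@map_mpoly n R S F).
Proof.
move=> inj_F p q /mpolyP pq; apply/mpolyP => m; apply: inj_F.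
by have := pq m; rewrite !mcoeff_map_mpoly.
Qed.

Lemma map_mpoly_coefp_mul (R : comNzRingType) (n k : nat)
    (P : {mpoly {poly R}[n]}) (g : {mpoly R[n]}) :
  map_mpoly (coefp k) (P * map_mpoly polyC g) = map_mpoly (coefp k) P * g.
Proof.
apply/mpolyP => m; rewrite mcoeff_map_mpoly [in LHS]mcoeffM /= coef_sum [RHS]mcoeffM.
apply: eq_bigr => mm _.
by rewrite (mcoeff_map_mpoly _ mm.2) coefMC (mcoeff_map_mpoly (coefp k) mm.1).
Qed.

(** For a common denominator Q of the multipliers, Q h is a combination of the
    g_i over K[t]. Comparing the coefficients of a power of t that occurs in Q
    gives h up to a nonzero constant. *)
Lemma ideal_membership_descent (K : fieldType) (n m : nat)
    (g : 'I_m -> {mpoly K[n]}) (h : {mpoly K[n]})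
    (iota := (tofrac \o polyC) : K -> {fraction {poly K}})
    (a : 'I_m -> {mpoly {fraction {poly K}}[n]}) :
  map_mpoly iota h = \sum_i a i * map_mpoly iota (g i) ->
  exists a' : 'I_m -> {mpoly K[n]}, h = \sum_i a' i * g i.
Proof.
move=> hE.
have /fin_all_exists2 [q q0 qP] i := mpoly_common_denominator (a i).
have /fin_all_exists [P PE] := qP.
pose Q := \prod_i q i.
have Q0 : Q != 0 by apply/prodf_neq0 => i _.
pose P' i := (\prod_(j | j != i) q j) *: P i.
have P'E i : map_mpoly tofrac (P' i) = tofrac Q *: a i.
  have -> : Q = (\prod_(j | j != i) q j) * q i by rewrite /Q (bigD1 i) //= mulrC.
  by rewrite /P' map_mpolyZ PE scalerA -rmorphM.
have iotaE p : map_mpoly iota p = map_mpoly tofrac (map_mpoly polyC p).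
  exact: map_mpoly_compE.
have inj_tofrac : injective (tofrac : {poly K} -> _).
  by move=> x y /eqP; rewrite tofrac_eq => /eqP.
have QE : Q%:MP * map_mpoly polyC h = \sum_i P' i * map_mpoly polyC (g i).
  apply: (map_mpoly_inj inj_tofrac).
  rewrite rmorphM /= map_mpolyC -iotaE hE rmorph_sum mulr_sumr.
  by apply: eq_bigr => i _; rewrite rmorphM /= P'E -iotaE mul_mpolyC scalerAl.
have [k c0] : exists k, Q`_k != 0.
  by exists (size Q).-1; rewrite -[Q`__]/(lead_coef Q) lead_coef_eq0.
exists (fun i => (Q`_k)^-1 *: map_mpoly (coefp k) (P' i)).
have := congr1 (map_mpoly (coefp k)) QE.
rewrite map_mpoly_coefp_mul map_mpolyC raddf_sum /=.
under eq_bigr do rewrite map_mpoly_coefp_mul.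
under [X in _ -> _ = X]eq_bigr do rewrite -scalerAl.
rewrite -scaler_sumr => <-.
by rewrite mul_mpolyC scalerA mulVf // scale1r.
Qed.

Theorem theorem4p11 (K : fieldType) (n d : nat) (hn : (1 <= n)%N)
    (L : {mpoly K[n]} -> Prop) (hL : forall p, L p -> tdeg_le p d)
    (f : {mpoly K[n]}) (hf : tdeg_le f d)
    (hk : exists k : nat, ideal_gen L (f ^+ k)) :
  ideal_gen L (f ^+ frakd n.+1 d.+1).
Proof.
case: hk => k [m [a [g [gL fk]]]].
pose iota := (tofrac \o polyC) : K -> {fraction {poly K}}.
pose e (i : nat) : {fraction {poly K}} := tofrac 'X^i.
have inj_e : injective e.
  move=> i j /eqP; rewrite tofrac_eq => /eqP /(congr1 (fun p : {poly K} => size p)).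
  by rewrite !size_polyXn => -[].
have td p : tdeg_le p d -> tdeg_le (map_mpoly iota p) d.
  move=> hp; rewrite /tdeg_le msizeE (perm_big _ (msupp_map_mpoly _ _)) -?msizeE //.
  exact: fmorph_inj.
have fkF : map_mpoly iota f ^+ k = \sum_i map_mpoly iota (a i) * map_mpoly iota (g i).
  by rewrite -rmorphXn fk rmorph_sum; apply: eq_bigr => i _; rewrite rmorphM.
have [a' fD] := nullstellensatz_exponent_infinite inj_e
  (fun i => td _ _ (hL _ (gL i))) (td _ _ hf) fkF.
rewrite -rmorphXn in fD.
have [b bE] := ideal_membership_descent fD.
by exists m, b, g.
Qed.
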